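(* For each integer $n\geq 1$ let $\tilde\delta_n(x):=\frac{n}{\pi}\,\frac{1}{1+n^2x^2}$ for $x\in\mathbb{R}$, and let $\delta_n(x):=\frac{\sin(nx)}{\pi x}$ for $x\neq 0$, $\delta_n(0):=\frac{n}{\pi}$. For $\epsilon>0$ let $$\tilde\delta^{\epsilon}(x):=\frac{1}{2\pi}\int_{-\infty}^{\infty}e^{ikx}e^{-|k|\epsilon}\,dk=\frac{\epsilon}{\pi}\,\frac{1}{x^2+\epsilon^2},\qquad x\in\mathbb{R},$$ so that $\tilde\delta_n=\tilde\delta^{1/n}$. Then the sequence $(\tilde\delta_n)$ is fundamental and $\langle\tilde\delta_n\rangle=\langle\delta_n\rangle$, i.e. the fundamental sequences $(\tilde\delta_n)$ and $(\delta_n)$ are equivalent. Moreover, for every test function $f\in\mathcal{D}$, $$\lim_{\epsilon\to 0^+}\tilde\delta^{\epsilon}[f]=f(0),\qquad\text{where}\quad \tilde\delta^{\epsilon}[f]:=\int_{-\infty}^{\infty}\tilde\delta^{\epsilon}(x)f(x)\,dx .$$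
   Context: $\mathcal{D}:=C_0^\infty(\mathbb{R})$ is the vector space of smooth complex-valued functions on $\mathbb{R}$ with compact support; its elements are called test functions. A sequence $(\varphi_n)$ of continuous functions $\varphi_n:\mathbb{R}\to\mathbb{C}$ is called a fundamental sequence if there exist an integer $k\geq 0$ and a sequence of functions $\Phi_n:\mathbb{R}\to\mathbb{C}$ such that $\Phi_n^{(k)}=\varphi_n$ on $\mathbb{R}$ for every $n$, and $(\Phi_n)$ converges uniformly on every bounded closed interval $[a,b]$ to some function $\Phi$. Two fundamental sequences $(\varphi_n)$ and $(\psi_n)$ are equivalent, written $(\varphi_n)\sim(\psi_n)$, if there exist an integer $k\geq 0$ and sequences of functions $\Phi_n,\Psi_n:\mathbb{R}\to\mathbb{C}$ with $\Phi_n^{(k)}=\varphi_n$ and $\Psi_n^{(k)}=\psi_n$ for every $n$, such that $(\Phi_n)$ and $(\Psi_n)$ converge uniformly on every bounded closed interval $[a,b]$ to the same function $\Phi$. This is an equivalence relation; the equivalence class of $(\varphi_n)$ is denoted $\langle\varphi_n\rangle$ and is called a distribution (in the sequential sense of Mikusiński and Sikorski). The sequence $(\delta_n)$ is a fundamental sequence. *)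

(* Defs.v *)
From Stdlib Require Import Reals.
From Coquelicot Require Import Coquelicot.
Open Scope R_scope.

(* F^(k) = f on all of R.  C is regarded as a normed space over R here:
   Coquelicot's default structure on C is the one over C itself. *)
Fixpoint is_nth_derivative (k : nat) (F f : R -> C) : Prop :=
  match k with
  | O => forall x : R, F x = f x
  | S k' => exists G : R -> C,
      (forall x : R, @is_derive R_AbsRing C_R_NormedModule F x (G x)) /\
      is_nth_derivative k' G f
  end.

Definition loc_unif_cv (Phi : nat -> R -> C) (L : R -> C) : Prop :=
  forall a b : R, a <= b ->
  forall e : R, 0 < e ->
  exists N : nat, forall n : nat, (N <= n)%nat ->
  forall x : R, a <= x <= b -> Cmod (Phi n x - L x)%C < e.

Definition fundamental (phi : nat -> R -> C) : Prop :=
  (forall (n : nat) (x : R), continuous (phi n) x) /\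
  exists (k : nat) (Phi : nat -> R -> C) (L : R -> C),
    (forall n : nat, is_nth_derivative k (Phi n) (phi n)) /\
    loc_unif_cv Phi L.

Definition equivalent (phi psi : nat -> R -> C) : Prop :=
  fundamental phi /\ fundamental psi /\
  exists (k : nat) (Phi Psi : nat -> R -> C) (L : R -> C),
    (forall n : nat, is_nth_derivative k (Phi n) (phi n)) /\
    (forall n : nat, is_nth_derivative k (Psi n) (psi n)) /\
    loc_unif_cv Phi L /\ loc_unif_cv Psi L.

(* The equivalence class <phi_n>, as a set of sequences. *)
Definition distr_class (phi : nat -> R -> C) : (nat -> R -> C) -> Prop :=
  fun psi => equivalent phi psi.

Definition test_function (f : R -> C) : Prop :=
  (forall k : nat, exists g : R -> C, is_nth_derivative k f g) /\
  compact (adherence (fun x : R => f x <> 0%C)).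

(* Improper Riemann integral over R, both bounds tending independently to
   infinity; [RIntC] is unspecified when [ex_RIntC] fails. *)
Definition ex_RIntC (g : R -> C) : Prop :=
  @ex_RInt_gen C_R_NormedModule g (Rbar_locally m_infty) (Rbar_locally p_infty).

Definition RIntC (g : R -> C) : C :=
  @RInt_gen C_R_CompleteNormedModule g
    (Rbar_locally m_infty) (Rbar_locally p_infty).

Definition Cexp (z : C) : C :=
  (exp (Re z) * cos (Im z), exp (Re z) * sin (Im z)).

Definition delta_tilde (n : nat) (x : R) : R :=
  INR n / PI * (1 / (1 + INR n ^ 2 * x ^ 2)).

Definition delta (n : nat) (x : R) : R :=
  if Req_EM_T x 0 then INR n / PI else sin (INR n * x) / (PI * x).

(* The sequence (u_n) for n >= 1, reindexed from 0 and viewed as C-valued. *)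
Definition seq_from_1 (u : nat -> R -> R) : nat -> R -> C :=
  fun m x => RtoC (u (S m) x).

Definition delta_eps_integrand (eps x k : R) : C :=
  (Cexp (Ci * RtoC k * RtoC x) * Cexp (RtoC (- Rabs k * eps)))%C.

Definition delta_eps (eps x : R) : C :=
  (RtoC (1 / (2 * PI)) * RIntC (fun k : R => delta_eps_integrand eps x k))%C.

Definition pairing (g f : R -> C) : C := RIntC (fun x : R => (g x * f x)%C).

(* Main.v *)
Require Import Defs.
From Stdlib Require Import Reals Lra Lia.
From Stdlib Require Import FunctionalExtensionality PropExtensionality.
From Coquelicot Require Import Coquelicot.
Open Scope R_scope.

(** Both sequences consist of dilations [n / PI * K (n x)] of a fixed kernel:
    [K y = 1 / (1 + y^2)] for [delta_tilde] and [K = sinc] for [delta].  Their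
    first primitives tend to a step function, so the convergence is not uniform
    near 0; their second primitives converge locally uniformly, and to the same
    limit [|x| / 2].  Indeed, if [m'' = K] then [m (n x) / (PI n)] is a second
    primitive of the dilated kernel, so it is enough that
    [m y = PI / 2 |y| + O(sqrt (1 + |y|))] ([cv_of_order_dilations]).  For the
    Cauchy kernel, [m y = y atan y - ln (1 + y^2) / 2].  For [sinc],
    [m y = y S(y) + cos y] with [S] the sine integral, and the estimate amounts
    to [S(y) = PI / 2 + O(1 / y)].  This refined form of the Dirichlet integral
    comes from rotating the contour: the proper integral
    [sine_tail r = int_0^(PI/2) Re (exp (i r e^(i t))) dt] equals [PI / 2] at
    [r = 0], has derivative [- sinc r], and is [O(1 / r)].  Hence
    [PI / 2 - sine_tail] is the sine integral, and no improper integral is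
    needed.

    Equality of the two equivalence classes requires transitivity of the relation
    ([equivalent_trans]).  The orders occurring in two equivalences can be made
    equal, since integrating from 0 raises the order and preserves locally
    uniform convergence.  If then [Phi] and [Phi'] are two families of primitives
    of the same order of the middle sequence, [Phi - Phi'] has vanishing
    derivative of that order, so adding it to a family of primitives for a third
    sequence changes the limit without changing what is represented.

    The Fourier integral is evaluated with an explicit primitive on each half
    line.  For the last limit, a continuous [f] satisfies
    [|f x - f 0| <= e + B x^2] on a bounded interval; as [x^2] times the Poisson
    kernel is at most [eps / PI], integrating gives
    [|pairing - f 0| <= e + K eps] ([poisson_approximate_identity]). *)

(** * Complex-valued functions of a real variable *)

(** The norm that the product structure puts on [C] squares the absolute values of the
    components, so it is not [Cmod] by conversion. *)
Lemma norm_C_R (z : C) : @norm R_AbsRing C_R_NormedModule z = Cmod z.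
Proof.
  change (sqrt (Rabs (fst z) * (Rabs (fst z) * 1) + Rabs (snd z) * (Rabs (snd z) * 1))
          = sqrt (fst z ^ 2 + snd z ^ 2)).
  f_equal.
  rewrite <- (pow2_abs (fst z)), <- (pow2_abs (snd z)).
  reflexivity.
Qed.

Lemma is_derive_RtoC (f : R -> R) (x l : R) :
  is_derive f x l ->
  @is_derive R_AbsRing C_R_NormedModule (fun t => RtoC (f t)) x (RtoC l).
Proof.
  intros Hf.
  assert (Hlin : @is_linear R_AbsRing R_NormedModule C_R_NormedModule RtoC).
  { split.
    - intros u v; apply injective_projections; simpl; [reflexivity | ].
      symmetry; apply Rplus_0_l.
    - intros u v; apply injective_projections; simpl; [reflexivity | ].
      symmetry; apply Rmult_0_r.
    - exists 1; split; [lra | intros u].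
      rewrite norm_C_R, Cmod_R, Rmult_1_l; apply Rle_refl. }
  unfold is_derive.
  eapply filterdiff_ext_lin.
  - apply (filterdiff_comp f RtoC _ RtoC Hf).
    apply filterdiff_linear, Hlin.
  - intros y; apply injective_projections; simpl; [reflexivity | ].
    symmetry; apply Rmult_0_r.
Qed.

Lemma continuous_RtoC (f : R -> R) (x : R) :
  continuous f x -> continuous (fun t => RtoC (f t)) x.
Proof.
  intros Hf.
  apply (continuous_comp_2 (U := R_UniformSpace) f (fun _ => 0)
           (fun a b => (a, b) : C)); [exact Hf | apply continuous_const | ].
  apply continuous_ext with (f := fun p : R * R => p).
  - intros [a b]; reflexivity.
  - apply continuous_id.
Qed.

Lemma is_nth_derivative_ext (k : nat) (F f g : R -> C) :
  (forall x, f x = g x) -> is_nth_derivative k F f -> is_nth_derivative k F g.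
Proof.
  intros Hfg; revert F; induction k as [|k IH]; simpl; intros F.
  - intros HF x; rewrite HF; apply Hfg.
  - intros [G [HG HGf]]; exists G; split; [exact HG | exact (IH G HGf)].
Qed.

Lemma is_nth_derivative_plus (k : nat) (F G f g : R -> C) :
  is_nth_derivative k F f -> is_nth_derivative k G g ->
  is_nth_derivative k (fun x => F x + G x)%C (fun x => f x + g x)%C.
Proof.
  revert F G; induction k as [|k IH]; simpl; intros F G.
  - intros HF HG x; rewrite HF, HG; reflexivity.
  - intros [F' [HF HF']] [G' [HG HG']].
    exists (fun x => F' x + G' x)%C; split; [intros x | exact (IH _ _ HF' HG')].
    apply (@is_derive_plus R_AbsRing C_R_NormedModule); auto.
Qed.

Lemma is_nth_derivative_opp (k : nat) (F f : R -> C) :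
  is_nth_derivative k F f ->
  is_nth_derivative k (fun x => - F x)%C (fun x => - f x)%C.
Proof.
  revert F; induction k as [|k IH]; simpl; intros F.
  - intros HF x; rewrite HF; reflexivity.
  - intros [F' [HF HF']].
    exists (fun x => - F' x)%C; split; [intros x | exact (IH _ HF')].
    apply (@is_derive_opp R_AbsRing C_R_NormedModule); auto.
Qed.

Lemma continuous_is_nth_derivative (k : nat) (F f : R -> C) :
  (forall x, continuous f x) -> is_nth_derivative k F f ->
  forall x, continuous F x.
Proof.
  intros Hf; destruct k as [|k]; simpl.
  - intros HF x; apply continuous_ext with (f := f); auto.
  - intros [G [HG _]] x.
    apply (@ex_derive_continuous R_AbsRing C_R_NormedModule).
    exists (G x); apply HG.
Qed.

(** * Locally uniform convergence *)

Lemma loc_unif_cv_plus (A B : nat -> R -> C) (a b : R -> C) :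
  loc_unif_cv A a -> loc_unif_cv B b ->
  loc_unif_cv (fun n x => A n x + B n x)%C (fun x => a x + b x)%C.
Proof.
  intros HA HB c d Hcd e He.
  destruct (HA c d Hcd (e / 2)) as [N1 H1]; [lra | ].
  destruct (HB c d Hcd (e / 2)) as [N2 H2]; [lra | ].
  exists (max N1 N2); intros n Hn x Hx.
  replace (A n x + B n x - (a x + b x))%C
    with ((A n x - a x) + (B n x - b x))%C by ring.
  apply Rle_lt_trans with (1 := Cmod_triangle _ _).
  assert (H1' := H1 n ltac:(lia) x Hx).
  assert (H2' := H2 n ltac:(lia) x Hx).
  lra.
Qed.

Lemma loc_unif_cv_opp (A : nat -> R -> C) (a : R -> C) :
  loc_unif_cv A a -> loc_unif_cv (fun n x => - A n x)%C (fun x => - a x)%C.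
Proof.
  intros HA c d Hcd e He.
  destruct (HA c d Hcd e He) as [N HN]; exists N; intros n Hn x Hx.
  replace (- A n x - - a x)%C with (- (A n x - a x))%C by ring.
  rewrite Cmod_opp; exact (HN n Hn x Hx).
Qed.

Lemma loc_unif_cv_ext (A : nat -> R -> C) (a b : R -> C) :
  (forall x, a x = b x) -> loc_unif_cv A a -> loc_unif_cv A b.
Proof.
  intros Hab HA c d Hcd e He.
  destruct (HA c d Hcd e He) as [N HN]; exists N; intros n Hn x Hx.
  rewrite <- Hab; exact (HN n Hn x Hx).
Qed.

(** The topology of [C] is generated by squares; this is the passage to the
    epsilon-delta form with discs, in which [loc_unif_cv] is stated. *)
Lemma continuous_C_R (f : R -> C) (x : R) :
  continuous f x <->
  forall e : R, 0 < e ->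
    exists d : R, 0 < d /\ forall y, Rabs (y - x) < d -> Cmod (f y - f x)%C < e.
Proof.
  split.
  - intros Hf e He.
    assert (H := proj1 (@filterlim_locally_ball_norm R_AbsRing R C_R_NormedModule
                   (locally x) _ f (f x)) Hf (mkposreal e He)).
    destruct H as [d Hd]; exists d; split; [apply cond_pos | intros y Hy].
    assert (H := Hd y Hy).
    unfold ball_norm in H; rewrite norm_C_R in H; exact H.
  - intros H.
    apply (proj2 (@filterlim_locally_ball_norm R_AbsRing R C_R_NormedModule
                   (locally x) _ f (f x))).
    intros e; destruct (H e (cond_pos e)) as [d [Hd HH]].
    exists (mkposreal d Hd); intros y Hy.
    unfold ball_norm; rewrite norm_C_R; exact (HH y Hy).
Qed.

Lemma loc_unif_cv_continuous (A : nat -> R -> C) (a : R -> C) :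
  (forall n x, continuous (A n) x) -> loc_unif_cv A a ->
  forall x, continuous a x.
Proof.
  intros HA Hcv x; apply continuous_C_R; intros e He.
  destruct (Hcv (x - 1) (x + 1) ltac:(lra) (e / 3) ltac:(lra)) as [N HN].
  destruct (proj1 (continuous_C_R _ _) (HA N x) (e / 3) ltac:(lra)) as [d [Hd HH]].
  exists (Rmin d 1); split; [apply Rmin_pos; lra | intros y Hy].
  assert (Hy1 : Rabs (y - x) < d) by (apply Rlt_le_trans with (1 := Hy), Rmin_l).
  assert (Hy2 : Rabs (y - x) < 1) by (apply Rlt_le_trans with (1 := Hy), Rmin_r).
  apply Rabs_def2 in Hy2.
  assert (H1 := HN N (le_n N) x ltac:(lra)).
  assert (H2 := HN N (le_n N) y ltac:(lra)).
  assert (H3 := HH y Hy1).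
  replace (a y - a x)%C
    with (- (A N y - a y) + (A N y - A N x) + (A N x - a x))%C by ring.
  apply Rle_lt_trans with (1 := Cmod_triangle _ _).
  apply Rle_lt_trans with (1 := Rplus_le_compat_r _ _ _ (Cmod_triangle _ _)).
  rewrite Cmod_opp; lra.
Qed.

(** The base point 0 is common to all functions, so that primitives of a convergent
    sequence converge without adjusting constants of integration. *)
Definition primitive (f : R -> C) (x : R) : C :=
  @RInt C_R_CompleteNormedModule f 0 x.

Lemma is_RInt_primitive (f : R -> C) (x : R) :
  (forall t, continuous f t) ->
  @is_RInt C_R_NormedModule f 0 x (primitive f x).
Proof.
  intros Hf.
  apply (@RInt_correct C_R_CompleteNormedModule).
  apply (@ex_RInt_continuous C_R_CompleteNormedModule).
  intros t _; apply Hf.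
Qed.

Lemma is_derive_primitive (f : R -> C) (x : R) :
  (forall t, continuous f t) ->
  @is_derive R_AbsRing C_R_NormedModule (primitive f) x (f x).
Proof.
  intros Hf.
  apply (@is_derive_RInt C_R_NormedModule f _ 0); [ | apply Hf].
  apply filter_forall; intros y; apply is_RInt_primitive, Hf.
Qed.

Lemma loc_unif_cv_primitive (A : nat -> R -> C) (a : R -> C) :
  (forall n x, continuous (A n) x) -> loc_unif_cv A a ->
  loc_unif_cv (fun n => primitive (A n)) (primitive a).
Proof.
  intros HA Hcv c d Hcd e He.
  assert (Ha := loc_unif_cv_continuous A a HA Hcv).
  set (M := Rmax (Rabs c) (Rabs d) + 1).
  assert (HM : 0 < M).
  { assert (H1 := Rabs_pos c); assert (H2 := Rmax_l (Rabs c) (Rabs d)).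
    unfold M; lra. }
  destruct (Hcv (- M) M ltac:(lra) (e / (2 * M))) as [N HN].
  { apply Rdiv_lt_0_compat; lra. }
  exists N; intros n Hn x Hx.
  assert (HxM : Rabs x <= M).
  { assert (H1 := Rmax_l (Rabs c) (Rabs d)).
    assert (H2 := Rmax_r (Rabs c) (Rabs d)).
    assert (H3 := RRle_abs d); assert (H4 := Rabs_maj2 c).
    apply Rabs_le; unfold M; lra. }
  assert (HI : @is_RInt C_R_NormedModule (fun t => (A n t - a t)%C) 0 x
                 (primitive (A n) x - primitive a x)%C).
  { apply (@is_RInt_minus C_R_NormedModule); apply is_RInt_primitive; auto. }
  assert (Hbound : Cmod (primitive (A n) x - primitive a x)%C
                   <= Rabs x * (e / (2 * M))).
  { apply Rabs_le_between in HxM.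
    destruct (Rle_or_lt 0 x) as [H0|H0].
    - rewrite (Rabs_pos_eq x H0), <- norm_C_R.
      replace x with (x - 0) at 3 by ring.
      apply (@norm_RInt_le_const C_R_NormedModule) with (3 := HI); [exact H0 | ].
      intros t Ht; rewrite norm_C_R; apply Rlt_le, HN; [exact Hn | lra].
    - rewrite (Rabs_left x H0).
      rewrite <- Cmod_opp, <- norm_C_R.
      replace (- x) with (0 - x) by ring.
      apply (@norm_RInt_le_const C_R_NormedModule) with
        (3 := @is_RInt_swap C_R_NormedModule _ _ _ _ HI); [lra | ].
      intros t Ht; rewrite norm_C_R; apply Rlt_le, HN; [exact Hn | lra]. }
  apply Rle_lt_trans with (1 := Hbound).
  apply Rle_lt_trans with (M * (e / (2 * M))).
  - apply Rmult_le_compat_r; [ | exact HxM].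
    apply Rlt_le, Rdiv_lt_0_compat; lra.
  - replace (M * (e / (2 * M))) with (e / 2) by (field; lra); lra.
Qed.

(** * Equivalence of fundamental sequences *)

(** The part of [fundamental] and [equivalent] that concerns a single sequence, with
    the order and the limit exposed: two sequences are equivalent when they share
    both. *)
Definition cv_of_order (k : nat) (phi : nat -> R -> C) (L : R -> C) : Prop :=
  exists Phi : nat -> R -> C,
    (forall n, is_nth_derivative k (Phi n) (phi n)) /\ loc_unif_cv Phi L.

Lemma cv_of_order_S (k : nat) (phi : nat -> R -> C) (L : R -> C) :
  (forall n x, continuous (phi n) x) ->
  cv_of_order k phi L -> cv_of_order (S k) phi (primitive L).
Proof.
  intros Hphi [Phi [HPhi Hcv]].
  assert (HC : forall n x, continuous (Phi n) x).
  { intros n; exact (continuous_is_nth_derivative k _ _ (Hphi n) (HPhi n)). }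
  exists (fun n => primitive (Phi n)); split.
  - intros n; exists (Phi n); split; [ | apply HPhi].
    intros x; apply is_derive_primitive, HC.
  - apply loc_unif_cv_primitive; assumption.
Qed.

(** The new limit depends only on [L] and [j], not on [phi]; hence the order can be
    raised for two equivalent sequences at once, keeping a common limit. *)
Lemma cv_of_order_add (j k : nat) (phi : nat -> R -> C) (L : R -> C) :
  (forall n x, continuous (phi n) x) ->
  cv_of_order k phi L -> cv_of_order (j + k) phi (Nat.iter j primitive L).
Proof.
  intros Hphi H; induction j as [|j IH]; simpl; [exact H | ].
  apply cv_of_order_S; assumption.
Qed.

(** Locally uniform limits of [k]-th primitives are determined only up to limits of
    functions with vanishing [k]-th derivative.  The difference of two families of
    primitives of [phi] is such a family, and adding it to primitives of [psi]
    moves their limit from [L'] to [L]. *)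
Lemma cv_of_order_transfer (k : nat) (phi psi : nat -> R -> C) (L L' : R -> C) :
  cv_of_order k phi L -> cv_of_order k phi L' ->
  cv_of_order k psi L' -> cv_of_order k psi L.
Proof.
  intros [Phi [HPhi HL]] [Phi' [HPhi' HL']] [Psi [HPsi HM]].
  exists (fun n x => Psi n x + (Phi n x + - Phi' n x))%C; split.
  - intros n.
    apply is_nth_derivative_ext
      with (f := fun x => (psi n x + (phi n x + - phi n x))%C).
    { intros x; ring. }
    apply is_nth_derivative_plus; [apply HPsi | ].
    apply is_nth_derivative_plus; [apply HPhi | ].
    apply is_nth_derivative_opp, HPhi'.
  - apply loc_unif_cv_ext with (a := fun x => (L' x + (L x + - L' x))%C).
    { intros x; ring. }
    apply loc_unif_cv_plus; [exact HM | ].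
    apply loc_unif_cv_plus; [exact HL | ].
    apply loc_unif_cv_opp, HL'.
Qed.

Lemma equivalent_iff (phi psi : nat -> R -> C) :
  equivalent phi psi <->
  (forall n x, continuous (phi n) x) /\ (forall n x, continuous (psi n) x) /\
  exists k L, cv_of_order k phi L /\ cv_of_order k psi L.
Proof.
  split.
  - intros [[Hphi _] [[Hpsi _] [k [Phi [Psi [L [H1 [H2 [H3 H4]]]]]]]]].
    split; [exact Hphi | split; [exact Hpsi | exists k, L; split]].
    + exists Phi; split; assumption.
    + exists Psi; split; assumption.
  - intros [Hphi [Hpsi [k [L [[Phi [H1 H2]] [Psi [H3 H4]]]]]]].
    split; [ | split].
    + split; [exact Hphi | exists k, Phi, L; split; assumption].
    + split; [exact Hpsi | exists k, Psi, L; split; assumption].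
    + exists k, Phi, Psi, L; repeat split; assumption.
Qed.

Lemma equivalent_sym (phi psi : nat -> R -> C) :
  equivalent phi psi -> equivalent psi phi.
Proof.
  rewrite !equivalent_iff.
  intros [Hphi [Hpsi [k [L [H1 H2]]]]].
  split; [exact Hpsi | split; [exact Hphi | exists k, L; split; assumption]].
Qed.

(** Both equivalences are lifted to order [m + k]; the limits obtained for the middle
    sequence [psi] may still differ, which [cv_of_order_transfer] repairs. *)
Lemma equivalent_trans (phi psi chi : nat -> R -> C) :
  equivalent phi psi -> equivalent psi chi -> equivalent phi chi.
Proof.
  rewrite !equivalent_iff.
  intros [Hphi [Hpsi [k [L [H1 H2]]]]] [_ [Hchi [m [L' [H3 H4]]]]].
  split; [exact Hphi | split; [exact Hchi | ]].
  exists (m + k)%nat, (Nat.iter m primitive L); split.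
  - apply cv_of_order_add; assumption.
  - apply cv_of_order_transfer
      with (phi := psi) (L' := Nat.iter k primitive L').
    + apply cv_of_order_add; assumption.
    + rewrite Nat.add_comm; apply cv_of_order_add; assumption.
    + rewrite Nat.add_comm; apply cv_of_order_add; assumption.
Qed.

Lemma distr_class_eq (phi psi : nat -> R -> C) :
  equivalent phi psi -> distr_class phi = distr_class psi.
Proof.
  intros H; apply functional_extensionality; intros chi.
  apply propositional_extensionality; unfold distr_class; split; intros H'.
  - exact (equivalent_trans _ _ _ (equivalent_sym _ _ H) H').
  - exact (equivalent_trans _ _ _ H H').
Qed.

(** * Dilations of a kernel *)

Lemma is_derive_dilation (f : R -> R) (a r x l : R) :
  is_derive f (r * x) l -> is_derive (fun t => a * f (r * t)) x (a * (r * l)).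
Proof.
  intros Hf; apply @is_derive_scal.
  apply (is_derive_comp f (fun t => r * t)); [exact Hf | ].
  auto_derive; [exact I | ring].
Qed.

(** The second primitive of the dilated kernel is [m (n x) / (PI n)], and its distance
    to [|x| / 2] is at most [c sqrt (1 + n |x|) / (PI n)], which is
    [O(1 / sqrt n)] on bounded sets.  The square root in the hypothesis leaves room
    for the logarithm that the Cauchy kernel produces. *)
Lemma cv_of_order_dilations (K s m : R -> R) (c : R) :
  0 < c ->
  (forall y, is_derive s y (K y)) -> (forall y, is_derive m y (s y)) ->
  (forall y, Rabs (m y - PI / 2 * Rabs y) <= c * sqrt (1 + Rabs y)) ->
  cv_of_order 2 (seq_from_1 (fun n x => INR n / PI * K (INR n * x)))
    (fun x => RtoC (Rabs x / 2)).
Proof.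
  intros Hc Hs Hm Hbound.
  exists (seq_from_1 (fun n x => m (INR n * x) / (PI * INR n))); split.
  - intros n.
    assert (Hn : 0 < INR (S n)) by apply lt_0_INR, Nat.lt_0_succ.
    assert (HPI := PI_RGT_0).
    exists (fun x => RtoC (s (INR (S n) * x) / PI)); split; [intros x | ].
    { apply is_derive_RtoC.
      replace (s (INR (S n) * x) / PI)
        with (/ (PI * INR (S n)) * (INR (S n) * s (INR (S n) * x)))
        by (field; lra).
      apply is_derive_ext with (f := fun t => / (PI * INR (S n)) * m (INR (S n) * t)).
      { intros t; unfold Rdiv; apply Rmult_comm. }
      apply is_derive_dilation, Hm. }
    exists (seq_from_1 (fun n x => INR n / PI * K (INR n * x)) n).
    split; [intros x | intros x; reflexivity].
    unfold seq_from_1; apply is_derive_RtoC.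
    replace (INR (S n) / PI * K (INR (S n) * x))
      with (/ PI * (INR (S n) * K (INR (S n) * x))) by (field; lra).
    apply is_derive_ext with (f := fun t => / PI * s (INR (S n) * t)).
    { intros t; unfold Rdiv; apply Rmult_comm. }
    apply is_derive_dilation, Hs.
  - intros a b Hab e He.
    set (M := Rmax (Rabs a) (Rabs b)).
    assert (HM : 0 <= M).
    { apply Rle_trans with (1 := Rabs_pos a), Rmax_l. }
    (* [c * sqrt ((1 + M) * r) < e * r] as soon as [r] exceeds this bound. *)
    destruct (INR_unbounded (c ^ 2 * (1 + M) / e ^ 2)) as [N HN].
    exists N; intros n Hn x Hx.
    assert (HxM : Rabs x <= M).
    { assert (H1 := Rmax_l (Rabs a) (Rabs b)).
      assert (H2 := Rmax_r (Rabs a) (Rabs b)).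
      assert (H3 := RRle_abs b); assert (H4 := Rabs_maj2 a).
      apply Rabs_le; unfold M; lra. }
    unfold seq_from_1; rewrite <- RtoC_minus, Cmod_R.
    set (r := INR (S n)).
    assert (Hr : c ^ 2 * (1 + M) / e ^ 2 < r).
    { apply Rlt_le_trans with (1 := HN), le_INR; lia. }
    assert (Hr1 : 1 <= r) by (change 1 with (INR 1); apply le_INR; lia).
    assert (HPI := PI2_1).
    assert (H := Hbound (r * x)).
    rewrite Rabs_mult, (Rabs_pos_eq r) in H by lra.
    replace (m (r * x) / (PI * r) - Rabs x / 2)
      with ((m (r * x) - PI / 2 * (r * Rabs x)) * / (PI * r)) by (field; lra).
    rewrite Rabs_mult, (Rabs_pos_eq (/ _))
      by (apply Rlt_le, Rinv_0_lt_compat, Rmult_lt_0_compat; lra).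
    apply Rle_lt_trans with (c * sqrt (1 + r * Rabs x) * / (PI * r)).
    { apply Rmult_le_compat_r; [ | exact H].
      apply Rlt_le, Rinv_0_lt_compat, Rmult_lt_0_compat; lra. }
    assert (Hsq : c * sqrt (1 + r * Rabs x) < e * r).
    { rewrite <- (sqrt_pow2 c), <- (sqrt_pow2 (e * r)) by nra.
      rewrite <- sqrt_mult_alt by nra.
      apply sqrt_lt_1_alt; split.
      { assert (H1 := Rabs_pos x); apply Rmult_le_pos; nra. }
      apply Rle_lt_trans with (c ^ 2 * (1 + M) * r).
      { rewrite Rmult_assoc; apply Rmult_le_compat_l; nra. }
      replace ((e * r) ^ 2) with (e ^ 2 * r * r) by ring.
      apply Rmult_lt_compat_r; [lra | ].
      rewrite (Rmult_comm (e ^ 2)); apply Rlt_div_l; [nra | exact Hr]. }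
    apply (Rmult_lt_reg_r (PI * r)); [nra | ].
    replace (c * sqrt (1 + r * Rabs x) * / (PI * r) * (PI * r))
      with (c * sqrt (1 + r * Rabs x)) by (field; lra).
    apply Rlt_le_trans with (1 := Hsq).
    apply Rmult_le_compat_l; nra.
Qed.

(** * The Cauchy kernel *)

(** The derivative of [t - atan t] is [1 - 1 / (1 + t^2)], which is nonnegative. *)
Lemma atan_le_id (z : R) : 0 <= z -> atan z <= z.
Proof.
  intros Hz.
  destruct (MVT_gen (fun t => t - atan t) 0 z (fun t => 1 - / (1 + t ^ 2)))
    as [t [_ Ht]].
  - intros t _; auto_derive; [exact I | ].
    field; nra.
  - intros t _; apply continuity_pt_filterlim.
    apply (ex_derive_continuous (fun t => t - atan t)); auto_derive; exact I.
  - rewrite atan_0 in Ht.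
    assert (/ (1 + t ^ 2) <= 1).
    { rewrite <- Rinv_1; apply Rinv_le_contravar; nra. }
    nra.
Qed.

(** With [s = sqrt (1 + |y|)], the inequality [s <= exp s] raised to the fourth power
    gives [1 + y^2 <= (1 + |y|)^2 = s^4 <= exp (4 s)]. *)
Lemma ln_1_sqr_le (y : R) : ln (1 + y ^ 2) <= 4 * sqrt (1 + Rabs y).
Proof.
  set (s := sqrt (1 + Rabs y)).
  assert (Hy := Rabs_pos y).
  assert (Hs : 1 <= s) by (unfold s; rewrite <- sqrt_1 at 1; apply sqrt_le_1_alt; lra).
  assert (Hs2 : s * s = 1 + Rabs y) by (apply sqrt_sqrt; lra).
  rewrite <- (ln_exp (4 * s)).
  apply Rcomplements.ln_le; [nra | ].
  replace (4 * s) with ((s + s) + (s + s)) by ring.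
  rewrite !exp_plus.
  assert (He : s <= exp s) by (assert (H := exp_ineq1_le s); lra).
  assert (He2 : s * s <= exp s * exp s) by (apply Rmult_le_compat; lra).
  apply Rle_trans with (s * s * (s * s)).
  - rewrite Hs2, <- (pow2_abs y); nra.
  - apply Rmult_le_compat; nra.
Qed.

Lemma cv_delta_tilde :
  cv_of_order 2 (seq_from_1 delta_tilde) (fun x => RtoC (Rabs x / 2)).
Proof.
  destruct (cv_of_order_dilations (fun y => / (1 + y ^ 2)) atan
              (fun y => y * atan y - ln (1 + y ^ 2) / 2) 3) as [Phi [H1 H2]].
  - lra.
  - intros y; auto_derive; [exact I | field; nra].
  - intros y; auto_derive; [nra | field; nra].
  - intros y.
    assert (Hln := ln_1_sqr_le y).
    assert (Hln0 : 0 <= ln (1 + y ^ 2)).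
    { rewrite <- ln_1; apply Rcomplements.ln_le; nra. }
    assert (Hs : 1 <= sqrt (1 + Rabs y)).
    { rewrite <- sqrt_1 at 1; apply sqrt_le_1_alt; assert (H := Rabs_pos y); lra. }
    (* For positive [z], [PI / 2 - atan z] is [atan (1 / z)], at most [1 / z]. *)
    assert (Hat : 0 <= PI / 2 * Rabs y - y * atan y <= 1).
    { assert (Hpos : forall z, 0 < z -> 0 <= PI / 2 * z - z * atan z <= 1).
      { intros z Hz.
        assert (Hinv := Rinv_0_lt_compat z Hz).
        assert (H1 := atan_inv z Hz).
        assert (H2 := atan_le_id (/ z) (Rlt_le _ _ Hinv)).
        assert (H3 := atan_bound z).
        assert (H4 : z * / z = 1) by (field; lra).
        split; nra. }
      destruct (Rtotal_order y 0) as [Hy|[->|Hy]].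
      - rewrite Rabs_left by exact Hy.
        assert (H := Hpos (- y) ltac:(lra)); rewrite atan_opp in H; lra.
      - rewrite Rabs_R0; lra.
      - rewrite Rabs_pos_eq by lra; apply Hpos, Hy. }
    apply Rabs_le; lra.
  - exists Phi; split; [ | exact H2].
    intros n; apply is_nth_derivative_ext with (2 := H1 n).
    intros x; unfold seq_from_1, delta_tilde; f_equal.
    field; split; [ | assert (H := PI_RGT_0); lra].
    assert (H := pow2_ge_0 (INR (S n) * x)); nra.
Qed.

(** * The sine integral *)

Definition sinc (y : R) : R := if Req_EM_T y 0 then 1 else sin y / y.

(** The real part of the integral of [exp (i z) / (i z)] over the quarter of the circle
    [|z| = r] in the first quadrant, that is of [exp (i r e^(i t))] over
    [0 <= t <= PI / 2].  It turns out to be the integral of [sinc] over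
    [[r, +oo)]. *)
Definition sine_tail (r : R) : R :=
  RInt (fun t => exp (- (r * sin t)) * cos (r * cos t)) 0 (PI / 2).

Lemma is_derive_sine_tail_integrand (r t : R) :
  is_derive (fun u => exp (- (u * sin t)) * cos (u * cos t)) r
    (- (exp (- (r * sin t)) * sin (t + r * cos t))).
Proof.
  auto_derive; [exact I | rewrite sin_plus; ring].
Qed.

Lemma continuity_2d_sine_tail_integrand (r t : R) :
  continuity_2d_pt (fun u v => - (exp (- (u * sin v)) * sin (v + u * cos v))) r t.
Proof.
  assert (Hs : continuity_2d_pt (fun _ v => sin v) r t).
  { apply continuity_1d_2d_pt_comp;
      [apply continuity_sin | apply continuity_2d_pt_id2]. }
  assert (Hc : continuity_2d_pt (fun _ v => cos v) r t).
  { apply continuity_1d_2d_pt_comp;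
      [apply continuity_cos | apply continuity_2d_pt_id2]. }
  apply continuity_2d_pt_opp, continuity_2d_pt_mult.
  - apply continuity_1d_2d_pt_comp.
    { apply derivable_continuous_pt, derivable_pt_exp. }
    apply continuity_2d_pt_opp, continuity_2d_pt_mult;
      [apply continuity_2d_pt_id1 | exact Hs].
  - apply continuity_1d_2d_pt_comp; [apply continuity_sin | ].
    apply continuity_2d_pt_plus; [apply continuity_2d_pt_id2 | ].
    apply continuity_2d_pt_mult; [apply continuity_2d_pt_id1 | exact Hc].
Qed.

(** Since [exp (i r e^(i t))] is holomorphic in [r e^(i t)], its derivatives in [r]
    and in [t] are proportional.  Hence, for [r <> 0], the derivative in [r] is also
    the derivative in [t] of [exp (- r sin t) sin (r cos t) / r], and its integral
    is a difference of boundary values: 0 at [t = PI / 2] and [sin r / r] at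
    [t = 0]. *)
Lemma is_RInt_sine_tail_derivative (r : R) :
  is_RInt (fun t => - (exp (- (r * sin t)) * sin (t + r * cos t))) 0 (PI / 2)
    (- sinc r).
Proof.
  unfold sinc; destruct (Req_EM_T r 0) as [->|Hr].
  - apply is_RInt_ext with (f := fun t => - sin t).
    { intros t _; rewrite !Rmult_0_l, Ropp_0, exp_0, Rplus_0_r; simpl; ring. }
    replace (- (1)) with (minus (cos (PI / 2)) (cos 0))
      by (rewrite cos_PI2, cos_0; unfold minus, plus, opp; simpl; ring).
    apply (is_RInt_derive (V := R_CompleteNormedModule) cos).
    + intros t _; auto_derive; [exact I | ring].
    + intros t _; apply (ex_derive_continuous (fun t => - sin t)).
      auto_derive; exact I.
  - set (F t := / r * (exp (- (r * sin t)) * sin (r * cos t))).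
    replace (- (sin r / r)) with (minus (F (PI / 2)) (F 0)).
    2: { unfold F, minus, plus, opp; simpl.
         rewrite cos_PI2, sin_PI2, cos_0, sin_0, !Rmult_0_r, Rmult_1_r, sin_0,
           Ropp_0, exp_0; field; exact Hr. }
    apply (is_RInt_derive (V := R_CompleteNormedModule) F).
    + intros t _; unfold F; auto_derive; [exact I | ].
      rewrite sin_plus; field; exact Hr.
    + intros t _.
      apply (ex_derive_continuous
               (fun t => - (exp (- (r * sin t)) * sin (t + r * cos t)))).
      auto_derive; exact I.
Qed.

Lemma is_derive_sine_tail (r : R) : is_derive sine_tail r (- sinc r).
Proof.
  set (f := fun u t => exp (- (u * sin t)) * cos (u * cos t)).
  assert (HD : forall u t, Derive (fun z => f z t) u
                = - (exp (- (u * sin t)) * sin (t + u * cos t))).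
  { intros u t; apply is_derive_unique, is_derive_sine_tail_integrand. }
  replace (- sinc r) with (RInt (fun t => Derive (fun u => f u t) r) 0 (PI / 2)).
  2: { rewrite (RInt_ext _ (fun t => - (exp (- (r * sin t)) * sin (t + r * cos t))))
         by (intros t _; apply HD).
       apply is_RInt_unique, is_RInt_sine_tail_derivative. }
  apply (is_derive_RInt_param f).
  - apply filter_forall; intros u t _; eexists.
    apply is_derive_sine_tail_integrand.
  - intros t _.
    apply continuity_2d_pt_ext with (2 := continuity_2d_sine_tail_integrand r t).
    intros u v; symmetry; apply HD.
  - apply filter_forall; intros u.
    apply (ex_RInt_continuous (V := R_CompleteNormedModule)); intros t _.
    apply (ex_derive_continuous (f u)); unfold f; auto_derive; exact I.
Qed.

Lemma sine_tail_0 : sine_tail 0 = PI / 2.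
Proof.
  unfold sine_tail.
  rewrite (RInt_ext _ (fun _ => 1)).
  - rewrite RInt_const; unfold scal; simpl; unfold mult; simpl; ring.
  - intros t _; rewrite !Rmult_0_l, Ropp_0, exp_0, cos_0; simpl; ring.
Qed.

(** The Taylor bound [sin t >= t - t^3 / 6] suffices with the crude [PI <= 4]: on the
    interval [t <= 2], so the right side is at least [t / 3].  The constant is less
    than the optimal [2 / PI], but only its positivity matters. *)
Lemma third_le_sin (t : R) : 0 <= t <= PI / 2 -> t / 3 <= sin t.
Proof.
  intros Ht.
  assert (HPI := PI_4).
  destruct (pre_sin_bound t 0 ltac:(lra) ltac:(lra)) as [H _].
  unfold sin_approx, sin_term in H; simpl in H.
  nra.
Qed.

(** Jordan's estimate: [exp (- r sin t) <= exp (- r t / 3)], whose integral over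
    [[0, +oo)] is [3 / r]. *)
Lemma Rabs_sine_tail_le (r : R) : 0 < r -> Rabs (sine_tail r) <= 3 / r.
Proof.
  intros Hr.
  assert (HPI := PI_RGT_0).
  set (F t := - (3 / r) * exp (- (r * (t / 3)))).
  assert (HI : is_RInt (fun t => exp (- (r * (t / 3)))) 0 (PI / 2)
                 (minus (F (PI / 2)) (F 0))).
  { apply (is_RInt_derive (V := R_CompleteNormedModule) F).
    - intros t _; unfold F, Rdiv; auto_derive; [exact I | field; lra].
    - intros t _; apply (ex_derive_continuous (fun t => exp (- (r * (t / 3))))).
      auto_derive; exact I. }
  apply Rle_trans with (minus (F (PI / 2)) (F 0)).
  - change (norm (sine_tail r) <= minus (F (PI / 2)) (F 0)).
    apply (norm_RInt_le (V := R_NormedModule)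
             (fun t => exp (- (r * sin t)) * cos (r * cos t))) with (4 := HI).
    + lra.
    + intros t Ht; change norm with Rabs; simpl.
      rewrite Rabs_mult, (Rabs_pos_eq (exp _)) by (apply Rlt_le, exp_pos).
      rewrite <- (Rmult_1_r (exp (- (r * (t / 3))))).
      apply Rmult_le_compat; [apply Rlt_le, exp_pos | apply Rabs_pos | | ].
      * assert (H := third_le_sin t Ht).
        apply Rnot_lt_le; intros Hlt; apply exp_lt_inv in Hlt; nra.
      * apply Rabs_le; assert (H := COS_bound (r * cos t)); lra.
    + apply (RInt_correct (V := R_CompleteNormedModule)).
      apply (ex_RInt_continuous (V := R_CompleteNormedModule)); intros t _.
      apply (ex_derive_continuous (fun t => exp (- (r * sin t)) * cos (r * cos t))).
      auto_derive; exact I.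
  - unfold F, minus, plus, opp; simpl.
    replace (- (r * (0 / 3))) with 0 by field.
    rewrite exp_0.
    assert (H1 := exp_pos (- (r * (PI / 2 / 3)))).
    assert (H2 : 0 < 3 / r) by (apply Rdiv_lt_0_compat; lra).
    nra.
Qed.

(** [sinc] is even, so [sine_tail (- t) + sine_tail t] has zero derivative; its value at
    0 is [PI].  In other words [PI / 2 - sine_tail] is odd, which reduces estimates
    on negative arguments to positive ones. *)
Lemma sine_tail_opp (r : R) : sine_tail (- r) = PI - sine_tail r.
Proof.
  assert (Hsinc : forall y, sinc (- y) = sinc y).
  { intros y; unfold sinc.
    destruct (Req_EM_T (- y) 0), (Req_EM_T y 0); try lra.
    rewrite sin_neg; field; assumption. }
  set (g t := sine_tail (- t) + sine_tail t).
  assert (Hg : forall t, is_derive g t 0).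
  { intros t.
    replace 0 with (plus (-1 * - sinc (- t)) (- sinc t))
      by (rewrite Hsinc; unfold plus; simpl; ring).
    apply @is_derive_plus; [ | apply is_derive_sine_tail].
    apply (is_derive_comp sine_tail Ropp); [apply is_derive_sine_tail | ].
    auto_derive; [exact I | ring]. }
  destruct (MVT_gen g 0 r (fun _ => 0)) as [t [_ Ht]].
  - intros t _; apply Hg.
  - intros t _; apply continuity_pt_filterlim.
    apply (ex_derive_continuous g); eexists; apply Hg.
  - unfold g in Ht; rewrite Ropp_0, sine_tail_0 in Ht; lra.
Qed.

Lemma continuous_sinc (y : R) : continuous sinc y.
Proof.
  destruct (Req_EM_T y 0) as [->|Hy].
  - apply continuity_pt_filterlim; intros e He.
    destruct (derivable_pt_lim_sin_0 e He) as [d Hd].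
    exists d; split; [apply cond_pos | ].
    intros h [[_ Hh] Hd']; simpl in Hd' |- *; unfold Rdist in *.
    unfold sinc; destruct (Req_EM_T 0 0) as [_|]; [ | lra].
    destruct (Req_EM_T h 0) as [Hh0|Hh0]; [rewrite Rminus_diag, Rabs_R0; lra | ].
    rewrite Rminus_0_r in Hd'.
    assert (H := Hd h Hh0 Hd').
    rewrite Rplus_0_l, sin_0, Rminus_0_r in H; exact H.
  - apply continuous_ext_loc with (g := fun t => sin t / t).
    + assert (Hpos : 0 < Rabs y) by (apply Rabs_pos_lt, Hy).
      exists (mkposreal _ Hpos); intros z Hz.
      unfold ball in Hz; simpl in Hz; unfold AbsRing_ball, abs, minus, plus, opp in Hz;
        simpl in Hz.
      unfold sinc; destruct (Req_EM_T z 0) as [->|]; [ | reflexivity].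
      rewrite Rplus_0_l, Rabs_Ropp in Hz; lra.
    + apply (ex_derive_continuous (fun t => sin t / t)); auto_derive; exact Hy.
Qed.

Lemma delta_sinc (n : nat) (x : R) :
  (1 <= n)%nat -> delta n x = INR n / PI * sinc (INR n * x).
Proof.
  intros Hn.
  assert (H0 : INR n <> 0) by (apply not_0_INR; lia).
  assert (HPI := PI_neq0).
  unfold delta, sinc.
  destruct (Req_EM_T x 0) as [->|Hx], (Req_EM_T (INR n * _) 0) as [H|H].
  - ring.
  - exfalso; apply H; ring.
  - exfalso; apply Rmult_integral in H; tauto.
  - field; repeat split; assumption.
Qed.

(** [PI / 2 - sine_tail] is a primitive of [sinc] tending to [PI / 2] at infinity, which
    is the Dirichlet integral; the rate [3 / r] bounds the error
    [y * sine_tail y] of the second primitive by a constant. *)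
Lemma cv_delta :
  cv_of_order 2 (seq_from_1 delta) (fun x => RtoC (Rabs x / 2)).
Proof.
  destruct (cv_of_order_dilations sinc (fun y => PI / 2 - sine_tail y)
              (fun y => y * (PI / 2 - sine_tail y) + cos y) 4) as [Phi [H1 H2]].
  - lra.
  - intros y.
    replace (sinc y) with (minus 0 (- sinc y))
      by (unfold minus, plus, opp; simpl; ring).
    apply @is_derive_minus; [apply @is_derive_const | apply is_derive_sine_tail].
  - intros y.
    assert (Hex : ex_derive sine_tail y) by (eexists; apply is_derive_sine_tail).
    auto_derive; [tauto | ].
    change (Derive (fun x => sine_tail x) y) with (Derive sine_tail y).
    rewrite (is_derive_unique sine_tail _ _ (is_derive_sine_tail y)).
    unfold sinc; destruct (Req_EM_T y 0) as [->|Hy].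
    + rewrite sin_0; ring.
    + field; exact Hy.
  - intros y.
    assert (Hs : 1 <= sqrt (1 + Rabs y)).
    { rewrite <- sqrt_1 at 1; apply sqrt_le_1_alt; assert (H := Rabs_pos y); lra. }
    assert (Hcos := COS_bound y).
    assert (Hpos : forall z, 0 < z -> - 3 <= z * sine_tail z <= 3).
    { intros z Hz; apply Rabs_le_between.
      rewrite Rabs_mult, (Rabs_pos_eq z) by lra.
      replace 3 with (z * (3 / z)) by (field; lra).
      apply Rmult_le_compat_l; [lra | apply Rabs_sine_tail_le, Hz]. }
    apply Rabs_le.
    destruct (Rtotal_order y 0) as [Hy|[->|Hy]].
    + rewrite Rabs_left in Hs |- * by exact Hy.
      assert (H := Hpos (- y) ltac:(lra)); rewrite sine_tail_opp in H; lra.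
    + rewrite Rabs_R0 in Hs |- *; lra.
    + rewrite Rabs_pos_eq in Hs |- * by lra.
      assert (H := Hpos y Hy); lra.
  - exists Phi; split; [ | exact H2].
    intros n; apply is_nth_derivative_ext with (2 := H1 n).
    intros x; unfold seq_from_1; f_equal; symmetry; apply delta_sinc; lia.
Qed.

Lemma equivalent_delta : equivalent (seq_from_1 delta_tilde) (seq_from_1 delta).
Proof.
  apply equivalent_iff; split; [ | split].
  - intros n x; unfold seq_from_1; apply continuous_RtoC.
    apply (ex_derive_continuous (delta_tilde (S n))); unfold delta_tilde.
    generalize (INR (S n)); intros r; auto_derive.
    assert (H := pow2_ge_0 (r * x)); nra.
  - intros n x; unfold seq_from_1; apply continuous_RtoC.
    apply continuous_ext with (f := fun t => INR (S n) / PI * sinc (INR (S n) * t)).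
    { intros t; symmetry; apply delta_sinc; lia. }
    apply @continuous_mult; [apply continuous_const | ].
    apply continuous_comp; [ | apply continuous_sinc].
    apply @continuous_mult; [apply continuous_const | apply continuous_id].
  - exists 2%nat; eexists; split; [exact cv_delta_tilde | exact cv_delta].
Qed.

(** * The Fourier integral of exp (- eps |k|) *)

(** Stated for arbitrary filters and vector values, so that it covers both half lines
    and complex integrands, and asks for differences of [F] to be integrals rather
    than for a derivative. *)
Lemma is_RInt_gen_primitive {V : NormedModule R_AbsRing}
    (Fa Fb : (R -> Prop) -> Prop) {FFa : Filter Fa} {FFb : Filter Fb}
    (g F : R -> V) (la lb : V) :
  filter_prod Fa Fb
    (fun ab => is_RInt g (fst ab) (snd ab) (minus (F (snd ab)) (F (fst ab)))) ->
  filterlim F Fa (locally la) -> filterlim F Fb (locally lb) ->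
  is_RInt_gen g Fa Fb (minus lb la).
Proof.
  intros HI Ha Hb.
  apply (filterlimi_lim_ext_loc
           (fun ab : R * R => minus (F (snd ab)) (F (fst ab)))).
  { exact HI. }
  unfold minus.
  eapply filterlim_comp_2 with
    (f := fun ab : R * R => F (snd ab)) (g := fun ab : R * R => opp (F (fst ab)))
    (h := plus); [ | | apply filterlim_plus].
  - eapply filterlim_comp; [apply filterlim_snd | exact Hb].
  - eapply filterlim_comp; [ | apply filterlim_opp].
    eapply filterlim_comp; [apply filterlim_fst | exact Ha].
Qed.

(** The components of [exp ((a + i x) k)]; the integrand of [delta_eps] is this with
    [a = eps] for negative [k] and [a = - eps] for positive [k]. *)
Definition damped_wave (a x k : R) : C :=
  (exp (a * k) * cos (k * x), exp (a * k) * sin (k * x)).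

(** The components of [exp ((a + i x) k) / (a + i x)]. *)
Definition damped_wave_primitive (a x k : R) : C :=
  (exp (a * k) * (a * cos (k * x) + x * sin (k * x)) / (a ^ 2 + x ^ 2),
   exp (a * k) * (a * sin (k * x) - x * cos (k * x)) / (a ^ 2 + x ^ 2)).

Lemma is_RInt_damped_wave (a x u v : R) :
  a <> 0 ->
  @is_RInt C_R_NormedModule (damped_wave a x) u v
    (@minus C_R_NormedModule
       (damped_wave_primitive a x v) (damped_wave_primitive a x u)).
Proof.
  intros Ha.
  assert (HD : a ^ 2 + x ^ 2 <> 0) by nra.
  apply (@is_RInt_fct_extend_pair R_NormedModule R_NormedModule).
  - apply (is_RInt_derive (V := R_CompleteNormedModule)
             (fun k => fst (damped_wave_primitive a x k))).
    + intros k _; simpl; unfold Rdiv; auto_derive; [exact I | field; nra].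
    + intros k _; apply (ex_derive_continuous (fun k => exp (a * k) * cos (k * x))).
      auto_derive; exact I.
  - apply (is_RInt_derive (V := R_CompleteNormedModule)
             (fun k => snd (damped_wave_primitive a x k))).
    + intros k _; simpl; unfold Rdiv; auto_derive; [exact I | field; nra].
    + intros k _; apply (ex_derive_continuous (fun k => exp (a * k) * sin (k * x))).
      auto_derive; exact I.
Qed.

Lemma Cmod_damped_wave_primitive (a x k : R) :
  a <> 0 ->
  Cmod (damped_wave_primitive a x k) = exp (a * k) / sqrt (a ^ 2 + x ^ 2).
Proof.
  intros Ha.
  assert (HD : 0 < a ^ 2 + x ^ 2) by nra.
  assert (Hs := sqrt_lt_R0 _ HD).
  assert (Hs2 := pow2_sqrt _ (Rlt_le _ _ HD)).
  assert (He := exp_pos (a * k)).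
  rewrite <- (sqrt_pow2 (exp (a * k) / sqrt (a ^ 2 + x ^ 2)))
    by (apply Rlt_le, Rdiv_lt_0_compat; assumption).
  unfold Cmod; f_equal; simpl fst; simpl snd.
  unfold Rdiv at 3; rewrite Rpow_mult_distr, pow_inv, Hs2.
  replace ((exp (a * k)) ^ 2) with
    ((exp (a * k)) ^ 2 * (Rsqr (sin (k * x)) + Rsqr (cos (k * x))))
    by (rewrite sin2_cos2; ring).
  unfold Rsqr; field; lra.
Qed.

Lemma filterlim_damped_wave_primitive (F : (R -> Prop) -> Prop) {FF : Filter F}
    (a x : R) :
  a <> 0 -> filterlim (fun k => a * k) F (Rbar_locally m_infty) ->
  filterlim (damped_wave_primitive a x) F (@locally C_UniformSpace (RtoC 0)).
Proof.
  intros Ha HF.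
  apply (proj2 (@filterlim_locally_ball_norm R_AbsRing R C_R_NormedModule
                  F _ (damped_wave_primitive a x) (RtoC 0))).
  intros e.
  assert (HD : 0 < sqrt (a ^ 2 + x ^ 2)) by (apply sqrt_lt_R0; nra).
  assert (Hev : F (fun k => exp (a * k) < e * sqrt (a ^ 2 + x ^ 2))).
  { apply (HF (fun y => exp y < e * sqrt (a ^ 2 + x ^ 2))).
    assert (Hpos : 0 < e * sqrt (a ^ 2 + x ^ 2)).
    { apply Rmult_lt_0_compat; [apply cond_pos | exact HD]. }
    exists (ln (e * sqrt (a ^ 2 + x ^ 2))); intros y Hy.
    rewrite <- (exp_ln _ Hpos); apply exp_increasing, Hy. }
  revert Hev; apply filter_imp; intros k Hk.
  unfold ball_norm; rewrite norm_C_R.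
  change (Cmod (damped_wave_primitive a x k - 0)%C < e).
  replace (damped_wave_primitive a x k - 0)%C
    with (damped_wave_primitive a x k) by ring.
  rewrite Cmod_damped_wave_primitive by exact Ha.
  apply Rlt_div_l; assumption.
Qed.

Lemma delta_eps_integrand_damped_wave (eps a x k : R) :
  - Rabs k * eps = a * k -> delta_eps_integrand eps x k = damped_wave a x k.
Proof.
  intros Ha; unfold delta_eps_integrand, damped_wave, Cexp; rewrite Ha.
  apply injective_projections; simpl;
    replace ((0 * k - 1 * 0) * x - (0 * 0 + 1 * k) * 0) with 0 by ring;
    replace ((0 * k - 1 * 0) * 0 + (0 * 0 + 1 * k) * x) with (k * x) by ring;
    rewrite exp_0, sin_0, cos_0; ring.
Qed.

Lemma filterlim_at_point {U : UniformSpace} (F : R -> U) (a : R) :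
  filterlim F (at_point a) (locally (F a)).
Proof.
  intros P HP; exact (locally_singleton _ _ HP).
Qed.

Lemma is_RInt_gen_delta_eps_integrand (eps x : R) :
  0 < eps ->
  @is_RInt_gen C_R_NormedModule (fun k => delta_eps_integrand eps x k)
    (Rbar_locally m_infty) (Rbar_locally p_infty)
    (RtoC (2 * eps / (x ^ 2 + eps ^ 2))).
Proof.
  intros Heps.
  set (E := damped_wave_primitive).
  replace (RtoC (2 * eps / (x ^ 2 + eps ^ 2))) with
    (@plus C_R_NormedModule
       (@minus C_R_NormedModule (E eps x 0) (RtoC 0))
       (@minus C_R_NormedModule (RtoC 0) (E (- eps) x 0))).
  2: { unfold E; apply injective_projections;
       unfold minus, plus, opp; simpl; unfold plus, opp; simpl;
       rewrite !Rmult_0_l, !Rmult_0_r, exp_0, cos_0, sin_0;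
       match goal with |- @eq _ ?u ?v => change (@eq R u v) end; field; nra. }
  apply (is_RInt_gen_Chasles (V := C_R_NormedModule)) with (b := 0).
  - apply (is_RInt_gen_ext (V := C_R_NormedModule) (damped_wave eps x)).
    { apply Filter_prod with (Q := fun a => a < 0) (R := fun b => b = 0).
      - exists 0; auto.
      - reflexivity.
      - simpl; intros a b Ha -> k; rewrite Rmax_right by lra; intros Hk.
        symmetry; apply delta_eps_integrand_damped_wave.
        rewrite Rabs_left; lra. }
    apply (is_RInt_gen_primitive (V := C_R_NormedModule)
             (Rbar_locally m_infty) (at_point 0) (damped_wave eps x) (E eps x)).
    + apply filter_forall; intros ab; apply is_RInt_damped_wave; lra.
    + apply (filterlim_damped_wave_primitive (Rbar_locally m_infty) eps x);
        [lra | ].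
      intros P [B HB]; exists (B / eps); intros k Hk; apply HB.
      rewrite Rmult_comm; apply Rlt_div_r; assumption.
    + apply (filterlim_at_point (U := C_UniformSpace)).
  - apply (is_RInt_gen_ext (V := C_R_NormedModule) (damped_wave (- eps) x)).
    { apply Filter_prod with (Q := fun a => a = 0) (R := fun b => 0 < b).
      - reflexivity.
      - exists 0; auto.
      - simpl; intros a b -> Hb k; rewrite Rmin_left by lra; intros Hk.
        symmetry; apply delta_eps_integrand_damped_wave.
        rewrite Rabs_pos_eq; lra. }
    apply (is_RInt_gen_primitive (V := C_R_NormedModule)
             (at_point 0) (Rbar_locally p_infty) (damped_wave (- eps) x) (E (- eps) x)).
    + apply filter_forall; intros ab; apply is_RInt_damped_wave; lra.
    + apply (filterlim_at_point (U := C_UniformSpace)).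
    + apply (filterlim_damped_wave_primitive (Rbar_locally p_infty) (- eps) x);
        [lra | ].
      intros P [B HB]; exists (- B / eps); intros k Hk; apply HB.
      apply Rlt_div_l in Hk; lra.
Qed.

Definition poisson (eps x : R) : R := eps / PI * (1 / (x ^ 2 + eps ^ 2)).

Lemma delta_eps_poisson (eps x : R) :
  0 < eps -> delta_eps eps x = RtoC (poisson eps x).
Proof.
  intros Heps.
  unfold delta_eps, RIntC.
  rewrite (@is_RInt_gen_unique C_R_CompleteNormedModule _ _ _ _ _ _
             (is_RInt_gen_delta_eps_integrand eps x Heps)).
  rewrite <- RtoC_mult; f_equal; unfold poisson.
  assert (HPI := PI_RGT_0); field; split; nra.
Qed.

Lemma delta_tilde_poisson (n : nat) (x : R) :
  (1 <= n)%nat -> delta_tilde n x = poisson (1 / INR n) x.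
Proof.
  intros Hn.
  assert (H0 : 0 < INR n) by (apply lt_0_INR; lia).
  assert (HPI := PI_RGT_0).
  unfold delta_tilde, poisson; field.
  assert (H := pow2_ge_0 (INR n * x)); repeat split; nra.
Qed.

(** * The Poisson kernel as an approximate identity *)

Lemma is_RInt_poisson (eps M : R) :
  0 < eps -> is_RInt (poisson eps) (- M) M (2 / PI * atan (M / eps)).
Proof.
  intros Heps.
  assert (HPI := PI_RGT_0).
  replace (2 / PI * atan (M / eps)) with
    (minus (/ PI * atan (M * / eps)) (/ PI * atan (- M * / eps))).
  2: { rewrite <- Ropp_mult_distr_l, atan_opp; unfold minus, plus, opp; simpl.
       unfold Rdiv; field; lra. }
  apply (is_RInt_derive (V := R_CompleteNormedModule)
           (fun x => / PI * atan (x * / eps))).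
  - intros x _; unfold poisson; auto_derive; [exact I | field; nra].
  - intros x _; apply (ex_derive_continuous (poisson eps)); unfold poisson.
    auto_derive; nra.
Qed.

Lemma is_RInt_RtoC_mult_const (p : R -> R) (a b l : R) (c : C) :
  is_RInt p a b l ->
  @is_RInt C_R_NormedModule (fun x => RtoC (p x) * c)%C a b (RtoC l * c)%C.
Proof.
  intros Hp.
  apply (@is_RInt_fct_extend_pair R_NormedModule R_NormedModule); simpl.
  - apply is_RInt_ext with (f := fun x => scal (fst c) (p x)).
    { intros x _; unfold scal; simpl; unfold mult; simpl; ring. }
    replace (l * fst c - 0 * snd c) with (scal (fst c) l)
      by (unfold scal; simpl; unfold mult; simpl; ring).
    apply (@is_RInt_scal R_NormedModule), Hp.
  - apply is_RInt_ext with (f := fun x => scal (snd c) (p x)).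
    { intros x _; unfold scal; simpl; unfold mult; simpl; ring. }
    replace (l * snd c + 0 * fst c) with (scal (snd c) l)
      by (unfold scal; simpl; unfold mult; simpl; ring).
    apply (@is_RInt_scal R_NormedModule), Hp.
Qed.

Lemma continuous_RtoC_mult (p : R -> R) (f : R -> C) (x : R) :
  continuous p x -> continuous f x -> continuous (fun t => RtoC (p t) * f t)%C x.
Proof.
  intros Hp Hf.
  apply continuous_ext with (f := fun t => @scal _ C_R_ModuleSpace (p t) (f t)).
  { intros t; apply injective_projections; unfold scal; simpl;
      unfold scal; simpl; unfold mult; simpl; ring. }
  apply (@continuous_scal _ R_AbsRing C_R_NormedModule); assumption.
Qed.

(** Continuity at 0 gives a radius [d] inside which [e] alone suffices; outside it,
    [x^2 >= d^2], so [B = h / d^2] works with [h] the maximum of [|f x - f 0|].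
    The quadratic term is what the Poisson kernel turns into [O(eps)]. *)
Lemma quadratic_modulus (f : R -> C) (M e : R) :
  0 <= M -> 0 < e -> (forall x, continuous f x) ->
  exists B, 0 <= B /\
    forall x, - M <= x <= M -> Cmod (f x - f 0)%C <= e + B * x ^ 2.
Proof.
  intros HM He Hf.
  set (h x := Cmod (f x - f 0)%C).
  assert (Hh : forall x, continuous h x).
  { intros x.
    apply continuous_ext with
      (f := fun t => @norm R_AbsRing C_R_NormedModule
                       (@minus C_R_NormedModule (f t) (f 0))).
    { intros t; apply norm_C_R. }
    apply (@continuous_comp R_UniformSpace C_UniformSpace R_UniformSpace).
    - apply (@continuous_minus R_UniformSpace R_AbsRing C_R_NormedModule);
        [apply Hf | apply continuous_const].
    - apply (@filterlim_norm R_AbsRing C_R_NormedModule). }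
  destruct (continuity_ab_maj h (- M) M) as [xm [Hxm _]]; [lra | | ].
  { intros c _; apply continuity_pt_filterlim, Hh. }
  destruct (proj1 (continuous_C_R f 0) (Hf 0) e He) as [d [Hd Hfd]].
  assert (Hpos : 0 <= h xm) by apply Cmod_ge_0.
  assert (Hd2 : 0 < d ^ 2) by nra.
  exists (h xm / d ^ 2); split.
  { apply Rmult_le_pos; [exact Hpos | apply Rlt_le, Rinv_0_lt_compat, Hd2]. }
  intros x Hx.
  destruct (Rlt_or_le (Rabs (x - 0)) d) as [Hxd|Hxd].
  - assert (H1 := Hfd x Hxd).
    assert (0 <= h xm / d ^ 2 * x ^ 2); [ | lra].
    apply Rmult_le_pos; [ | apply pow2_ge_0].
    apply Rmult_le_pos; [exact Hpos | apply Rlt_le, Rinv_0_lt_compat, Hd2].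
  - rewrite Rminus_0_r in Hxd.
    apply Rle_trans with (1 := Hxm x Hx).
    assert (Hdx : d ^ 2 <= x ^ 2) by (rewrite <- (pow2_abs x); apply pow_incr; lra).
    assert (h xm <= h xm / d ^ 2 * x ^ 2); [ | lra].
    replace (h xm / d ^ 2 * x ^ 2) with (h xm * x ^ 2 / d ^ 2) by (field; lra).
    apply Rle_div_r; nra.
Qed.

(** The kernel has mass [m = 2 / PI atan (M / eps)] on [[- M, M]].  The integral is
    compared with [m f 0] through [quadratic_modulus] and [x^2 poisson <= eps / PI],
    and [m f 0] with [f 0] through [1 - m <= 2 eps / (PI M)].  The constant [K]
    is the sum of the two rates. *)
Lemma poisson_approximate_identity (f : R -> C) (M e : R) :
  0 < M -> 0 < e -> (forall x, continuous f x) ->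
  exists K, 0 <= K /\
    forall (eps : R) (I : C), 0 < eps ->
      @is_RInt C_R_NormedModule (fun x => RtoC (poisson eps x) * f x)%C (- M) M I ->
      Cmod (I - f 0)%C <= e + K * eps.
Proof.
  intros HM He Hf.
  destruct (quadratic_modulus f M e (Rlt_le _ _ HM) He Hf) as [B [HB Hmod]].
  assert (HPI := PI_RGT_0).
  assert (HC := Cmod_ge_0 (f 0)).
  exists (2 * M * B / PI + 2 / PI / M * Cmod (f 0)); split.
  { apply Rplus_le_le_0_compat.
    - apply Rmult_le_pos; [nra | apply Rlt_le, Rinv_0_lt_compat, HPI].
    - apply Rmult_le_pos; [ | exact HC].
      apply Rlt_le; repeat apply Rdiv_lt_0_compat; lra. }
  intros eps I Heps HI.
  assert (HP := is_RInt_poisson eps M Heps).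
  set (m := 2 / PI * atan (M / eps)) in HP.
  assert (Hpp : forall x, 0 <= poisson eps x /\ poisson eps x * x ^ 2 <= eps / PI).
  { intros x; unfold poisson.
    assert (H1 : 0 < x ^ 2 + eps ^ 2) by nra.
    assert (H2 := Rdiv_lt_0_compat _ _ Heps HPI).
    assert (H3 := Rinv_0_lt_compat _ H1).
    split; [unfold Rdiv at 2; nra | ].
    rewrite <- (Rmult_1_r (eps / PI)) at 2; rewrite Rmult_assoc.
    apply Rmult_le_compat_l; [lra | ].
    replace (1 / (x ^ 2 + eps ^ 2) * x ^ 2)
      with (x ^ 2 / (x ^ 2 + eps ^ 2)) by (field; lra).
    apply Rle_div_l; nra. }
  (* [1 - m = 2 / PI * atan (eps / M)], and [atan z <= z]. *)
  assert (Hm : 1 - 2 / PI / M * eps <= m <= 1).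
  { assert (HMe : 0 < M / eps) by (apply Rdiv_lt_0_compat; lra).
    assert (H1 := atan_inv _ HMe).
    assert (H2 := atan_le_id _ (Rlt_le _ _ (Rinv_0_lt_compat _ HMe))).
    assert (H3 := atan_bound (M / eps)).
    assert (H4 : 0 < 2 / PI) by (apply Rdiv_lt_0_compat; lra).
    replace (2 / PI / M * eps) with (2 / PI * / (M / eps)) by (field; lra).
    replace 1 with (2 / PI * (PI / 2)) by (field; lra).
    unfold m; split; nra. }
  assert (H1 : Cmod (I - RtoC m * f 0)%C <= e * m + (M - - M) * (B * (eps / PI))).
  { rewrite <- norm_C_R.
    apply (@norm_RInt_le C_R_NormedModule
             (fun x => RtoC (poisson eps x) * f x - RtoC (poisson eps x) * f 0)%C
             (fun x => e * poisson eps x + B * (eps / PI)) (- M) M).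
    - lra.
    - intros x Hx; rewrite norm_C_R.
      replace (RtoC (poisson eps x) * f x - RtoC (poisson eps x) * f 0)%C
        with (RtoC (poisson eps x) * (f x - f 0))%C by ring.
      destruct (Hpp x) as [Hp1 Hp2].
      rewrite Cmod_mult, Cmod_R, (Rabs_pos_eq _ Hp1).
      apply Rle_trans with (poisson eps x * (e + B * x ^ 2)).
      + apply Rmult_le_compat_l; [exact Hp1 | apply Hmod, Hx].
      + nra.
    - apply (@is_RInt_minus C_R_NormedModule); [exact HI | ].
      apply is_RInt_RtoC_mult_const, HP.
    - apply (@is_RInt_plus R_NormedModule).
      + apply (@is_RInt_scal R_NormedModule), HP.
      + apply (@is_RInt_const R_NormedModule). }
  assert (H2 : Cmod (RtoC m * f 0 - f 0)%C <= 2 / PI / M * eps * Cmod (f 0)).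
  { replace (RtoC m * f 0 - f 0)%C with (RtoC (m - 1) * f 0)%C
      by (rewrite RtoC_minus; ring).
    rewrite Cmod_mult, Cmod_R.
    apply Rmult_le_compat_r; [exact HC | ].
    apply Rabs_le; lra. }
  replace (I - f 0)%C with ((I - RtoC m * f 0) + (RtoC m * f 0 - f 0))%C by ring.
  apply Rle_trans with (1 := Cmod_triangle _ _).
  replace ((2 * M * B / PI + 2 / PI / M * Cmod (f 0)) * eps)
    with ((M - - M) * (B * (eps / PI)) + 2 / PI / M * eps * Cmod (f 0))
    by (field; lra).
  nra.
Qed.

(** * Pairing with test functions *)

Lemma is_RInt_gen_compact_support {V : NormedModule R_AbsRing}
    (g : R -> V) (M : R) (l : V) :
  0 <= M -> (forall x, M < Rabs x -> g x = zero) -> is_RInt g (- M) M l ->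
  is_RInt_gen g (Rbar_locally m_infty) (Rbar_locally p_infty) l.
Proof.
  intros HM Hg Hl.
  assert (Hzero : forall a b, (forall x, Rmin a b < x < Rmax a b -> M < Rabs x) ->
                    is_RInt g a b zero).
  { intros a b Hab.
    apply is_RInt_ext with (f := fun _ => zero).
    { intros x Hx; symmetry; apply Hg, Hab, Hx. }
    assert (H := @is_RInt_const V a b zero).
    exact (eq_ind _ _ H _ (scal_zero_r (V := V) (b - a))). }
  apply (filterlimi_lim_ext_loc (fun _ : R * R => l)); [ | apply filterlim_const].
  apply Filter_prod with (Q := fun a => a < - M) (R := fun b => M < b).
  - exists (- M); intros a Ha; exact Ha.
  - exists M; intros b Hb; exact Hb.
  - intros a b Ha Hb; simpl.
    replace l with (plus (plus zero l) (@zero V))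
      by (rewrite plus_zero_l, plus_zero_r; reflexivity).
    apply is_RInt_Chasles with M; [apply is_RInt_Chasles with (- M) | ].
    + apply Hzero; intros x; rewrite Rmin_left, Rmax_right by lra.
      intros Hx; rewrite Rabs_left1; lra.
    + exact Hl.
    + apply Hzero; intros x; rewrite Rmin_left, Rmax_right by lra.
      intros Hx; rewrite Rabs_pos_eq; lra.
Qed.

Lemma test_function_continuous (f : R -> C) :
  test_function f -> forall x, continuous f x.
Proof.
  intros [Hf _] x.
  destruct (Hf 1%nat) as [g [G [HG _]]].
  apply (@ex_derive_continuous R_AbsRing C_R_NormedModule).
  exists (G x); apply HG.
Qed.

Lemma test_function_support (f : R -> C) :
  test_function f -> exists M, 0 < M /\ forall x, M < Rabs x -> f x = 0%C.
Proof.
  intros [_ Hf].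
  destruct (compact_P1 _ Hf) as [a [b Hab]].
  assert (H1 := Rmax_l (Rabs a) (Rabs b)).
  assert (H2 := Rmax_r (Rabs a) (Rabs b)).
  assert (H3 := RRle_abs b); assert (H4 := Rabs_maj2 a).
  assert (H5 := Rabs_pos a).
  exists (Rmax (Rabs a) (Rabs b) + 1); split; [lra | intros x Hx].
  destruct (Ceq_dec (f x) 0%C) as [H|H]; [exact H | exfalso].
  assert (Hx' := Hab x (adherence_P1 _ x H)).
  assert (Rabs x <= Rmax (Rabs a) (Rabs b)); [apply Rabs_le | ]; lra.
Qed.

Lemma is_RInt_gen_pairing (f : R -> C) (M eps : R) :
  0 < eps -> 0 <= M ->
  (forall x, continuous f x) -> (forall x, M < Rabs x -> f x = 0%C) ->
  exists I : C,
    @is_RInt C_R_NormedModule (fun x => RtoC (poisson eps x) * f x)%C (- M) M I /\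
    @is_RInt_gen C_R_NormedModule (fun x => delta_eps eps x * f x)%C
      (Rbar_locally m_infty) (Rbar_locally p_infty) I.
Proof.
  intros Heps HM Hf Hsupp.
  set (g := fun x => (RtoC (poisson eps x) * f x)%C).
  exists (@RInt C_R_CompleteNormedModule g (- M) M).
  assert (HI : @is_RInt C_R_NormedModule g (- M) M
                 (@RInt C_R_CompleteNormedModule g (- M) M)).
  { apply (@RInt_correct C_R_CompleteNormedModule).
    apply (@ex_RInt_continuous C_R_CompleteNormedModule); intros x _.
    apply continuous_RtoC_mult; [ | apply Hf].
    apply (ex_derive_continuous (poisson eps)); unfold poisson.
    auto_derive; nra. }
  split; [exact HI | ].
  apply (is_RInt_gen_ext (V := C_R_NormedModule) g).
  { apply filter_forall; intros ab x _; unfold g.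
    rewrite delta_eps_poisson by exact Heps; reflexivity. }
  apply (is_RInt_gen_compact_support (V := C_R_NormedModule)) with (3 := HI); [exact HM | ].
  intros x Hx; unfold g; rewrite (Hsupp x Hx).
  change (RtoC (poisson eps x) * 0 = RtoC 0)%C; ring.
Qed.

Lemma filterlim_pairing_delta_eps (f : R -> C) :
  test_function f ->
  filterlim (fun eps => pairing (delta_eps eps) f) (at_right 0) (locally (f 0)).
Proof.
  intros Htest.
  assert (Hf := test_function_continuous f Htest).
  destruct (test_function_support f Htest) as [M [HM Hsupp]].
  apply (proj2 (@filterlim_locally_ball_norm R_AbsRing R C_R_NormedModule
                  (at_right 0) _ (fun eps => pairing (delta_eps eps) f) (f 0))).
  intros e; assert (He := cond_pos e).
  destruct (poisson_approximate_identity f M (e / 2) HM ltac:(lra) Hf)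
    as [K [HK Hbound]].
  assert (Hd : 0 < e / (2 * (K + 1))) by (apply Rdiv_lt_0_compat; lra).
  exists (mkposreal _ Hd); intros eps Hball Heps.
  assert (Hlt : eps < e / (2 * (K + 1))).
  { unfold ball in Hball; simpl in Hball.
    unfold AbsRing_ball, abs, minus, plus, opp in Hball; simpl in Hball.
    apply Rabs_def2 in Hball; lra. }
  destruct (is_RInt_gen_pairing f M eps Heps (Rlt_le _ _ HM) Hf Hsupp) as [I [HI HIgen]].
  unfold ball_norm; rewrite norm_C_R.
  unfold pairing, RIntC.
  rewrite (@is_RInt_gen_unique C_R_CompleteNormedModule _ _ _ _ _ _ HIgen).
  apply Rle_lt_trans with (1 := Hbound eps I Heps HI).
  apply Rlt_div_r in Hlt; [nra | lra].
Qed.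

Theorem lemma5 :
  (forall eps x : R, 0 < eps ->
     ex_RIntC (fun k : R => delta_eps_integrand eps x k) /\
     delta_eps eps x = RtoC (eps / PI * (1 / (x ^ 2 + eps ^ 2)))) /\
  (forall (n : nat) (x : R), (1 <= n)%nat ->
     RtoC (delta_tilde n x) = delta_eps (1 / INR n) x) /\
  fundamental (seq_from_1 delta_tilde) /\
  distr_class (seq_from_1 delta_tilde) = distr_class (seq_from_1 delta) /\
  equivalent (seq_from_1 delta_tilde) (seq_from_1 delta) /\
  (forall f : R -> C, test_function f ->
     (forall eps : R, 0 < eps -> ex_RIntC (fun x : R => (delta_eps eps x * f x)%C)) /\
     filterlim (fun eps : R => pairing (delta_eps eps) f)
       (at_right 0) (locally (f 0))).
Proof.
  split; [ | split; [ | split; [ | split; [ | split]]]].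
  - intros eps x Heps; split; [ | exact (delta_eps_poisson eps x Heps)].
    exists (RtoC (2 * eps / (x ^ 2 + eps ^ 2))).
    exact (is_RInt_gen_delta_eps_integrand eps x Heps).
  - intros n x Hn.
    rewrite delta_tilde_poisson, delta_eps_poisson; [reflexivity | | exact Hn].
    apply Rdiv_lt_0_compat; [lra | apply lt_0_INR; lia].
  - apply equivalent_delta.
  - apply distr_class_eq, equivalent_delta.
  - exact equivalent_delta.
  - intros f H; split; [ | exact (filterlim_pairing_delta_eps f H)].
    intros eps Heps.
    destruct (test_function_support f H) as [M [HM Hsupp]].
    destruct (is_RInt_gen_pairing f M eps Heps (Rlt_le _ _ HM)
                (test_function_continuous f H) Hsupp) as [I [_ HI]].
    exists I; exact HI.
Qed.
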